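(* Let $d\ge 2$ and let $\varphi=\sum_{i=0}^{d-1}\alpha_i e_i\otimes e_i\in\mathbb{C}^d\otimes\mathbb{C}^d$, where $\alpha_0\ge\cdots\ge\alpha_{d-1}>0$ and $\sum_{i=0}^{d-1}\alpha_i^2=1$. Let $\mathcal{M}\subseteq\mathcal{B}(\mathcal{H})$ be a von Neumann algebra and let $\psi\in\mathcal{H}$ be a unit vector. (1) If $(R,\psi)$ exactly embezzles $\varphi$ in $(\mathcal{M},\mathcal{H})$, then there is a unitary $U\in M_d\otimes\mathcal{M}$ and a unit vector $\zeta\in\mathcal{H}$ such that $(U,\zeta)$ exactly embezzles $\varphi$ in $(\mathcal{M},\mathcal{H})$. (2) If $(R,T,\psi)$ exactly embezzles $\varphi$ in $(\mathcal{M},\mathcal{M}',\mathcal{H})$, then there are unitaries $U\in M_d\otimes\mathcal{M}$ and $V\in\mathcal{M}'\otimes M_d$, along with a unit vector $\eta\in\mathcal{H}$, so that $(U,V,\eta)$ exactly embezzles $\varphi$ in $(\mathcal{M},\mathcal{M}',\mathcal{H})$.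
   Context: $\{e_0,\dots,e_{d-1}\}$ is the canonical orthonormal basis of $\mathbb{C}^d$; $\mathcal{M}'$ is the commutant; inner products are linear in the first variable. Write $R=\sum_{i,j=0}^{d-1}E_{ij}\otimes R_{ij}$ with $R_{ij}\in\mathcal{M}$, $E_{ij}$ the matrix units of $M_d$. Monopartite: $(R,\psi)$ exactly embezzles $\varphi$ in $(\mathcal{M},\mathcal{H})$ if $R\in M_d\otimes\mathcal{M}$ is a contraction, $\psi\in\mathcal{H}$ is a unit vector and, with $\omega=\langle(\cdot)\psi,\psi\rangle$ on $\mathcal{M}$, $\omega(R_{i0}^*XR_{j0})=\delta_{ij}\alpha_i^2\omega(X)$ for all $X\in\mathcal{M}$ and $i,j=0,\dots,d-1$. Bipartite: $(R,T,\psi)$ exactly embezzles $\varphi$ in $(\mathcal{M},\mathcal{M}',\mathcal{H})$ if $R\in M_d\otimes\mathcal{M}$ (acting on $\mathbb{C}^d\otimes\mathcal{H}$) and $T\in\mathcal{M}'\otimes M_d$ (acting on $\mathcal{H}\otimes\mathbb{C}^d$) are contractions, $\psi\in\mathcal{H}$ is a unit vector, and $(R\otimes I_d)(I_d\otimes T)(e_0\otimes\psi\otimes e_0)=\sum_{i=0}^{d-1}\alpha_i\,e_i\otimes\psi\otimes e_i$. *)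

(* Defs.v *)
From HB Require Import structures.
From mathcomp Require Import all_boot all_order all_algebra.
From mathcomp Require Import all_classical all_reals all_analysis.
From mathcomp Require Import sesquilinear complex.

Set Implicit Arguments.
Unset Strict Implicit.
Unset Printing Implicit Defensive.

Import Order.TTheory GRing.Theory Num.Theory.
Import numFieldNormedType.Exports.

Local Open Scope classical_set_scope.
Local Open Scope complex_scope.
Local Open Scope ring_scope.

(* A complex Hilbert space is a complete normed space H over R[i] with a
   positive definite Hermitian form ip : {dot H for Num.conj} such that
   [hilbert_norm ip] holds. Forms of type {dot H for Num.conj} are linear in
   the first variable and conjugate-linear in the second. *)
Section HilbertSpace.
Context {R : realType} {H : completeNormedModType R[i]}.
Variable ip : {dot H for (@Num.conj R[i])}.

Definition hilbert_norm := forall x : H, `|x| ^+ 2 = ip x x.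

Definition bounded_operator : set (H -> H) :=
  [set a | linear a /\ exists k : R[i], forall x, `|a x| <= k * `|x|].

Definition is_adjoint (a b : H -> H) := forall x y, ip (a x) y = ip x (b y).

(* The adjoint exists and is unique when a is a bounded operator; the value is
   junk otherwise. *)
Definition adjoint (a : H -> H) : H -> H := xget (0 : H -> H) (is_adjoint a).

Definition commutant (M : set (H -> H)) : set (H -> H) :=
  [set b | bounded_operator b /\ forall a, M a -> a \o b = b \o a].

Record von_neumann_algebra (M : set (H -> H)) : Prop := VonNeumannAlgebra {
  vna_bounded : M `<=` bounded_operator;
  vna_id : M idfun;
  vna_add : forall a b, M a -> M b -> M (a + b);
  vna_scale : forall (k : R[i]) a, M a -> M (k *: a);
  vna_comp : forall a b, M a -> M b -> M (a \o b);
  vna_adjoint : forall a, M a -> M (adjoint a);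
  vna_bicommutant : commutant (commutant M) = M
}.

(* \sum_(i, j) E_ij (x) A_ij in M_d (x) B(H), and likewise
   \sum_(i, j) A_ij (x) E_ij in B(H) (x) M_d, is the operator matrix A.
   The spaces C^d (x) H and H (x) C^d are both {ffun 'I_d -> H} with the
   l^2-norm, and C^d (x) H (x) C^d is {ffun 'I_d * 'I_d -> H}, where the value
   at (i, j) is the coefficient of e_i (x) _ (x) e_j. *)
Section OperatorMatrices.
Variable d : nat.
Implicit Types A B : 'M[H -> H]_d.

Definition entries_in (M : set (H -> H)) A := forall i j, M (A i j).

Definition opmx_act A (v : {ffun 'I_d -> H}) : {ffun 'I_d -> H} :=
  [ffun i => \sum_j A i j (v j)].

Definition contraction A := forall v : {ffun 'I_d -> H},
  \sum_i `|opmx_act A v i| ^+ 2 <= \sum_i `|v i| ^+ 2.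

Definition opmx_one : 'M[H -> H]_d :=
  \matrix_(i, j) (if i == j then idfun else 0).

Definition opmx_mul A B : 'M[H -> H]_d :=
  \matrix_(i, j) \sum_k (A i k \o B k j).

Definition opmx_adjoint A : 'M[H -> H]_d := \matrix_(i, j) adjoint (A j i).

Definition opmx_unitary A :=
  opmx_mul (opmx_adjoint A) A = opmx_one /\
  opmx_mul A (opmx_adjoint A) = opmx_one.

(* A (x) I_d *)
Definition act_left A (v : {ffun 'I_d * 'I_d -> H}) : {ffun 'I_d * 'I_d -> H} :=
  [ffun ij => \sum_k A ij.1 k (v (k, ij.2))].

(* I_d (x) A *)
Definition act_right A (v : {ffun 'I_d * 'I_d -> H}) :
    {ffun 'I_d * 'I_d -> H} :=
  [ffun ij => \sum_k A ij.2 k (v (ij.1, k))].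

(* e_i (x) psi (x) e_j *)
Definition basis_tensor (i : 'I_d) (psi : H) (j : 'I_d) :
    {ffun 'I_d * 'I_d -> H} :=
  [ffun kl => if kl == (i, j) then psi else 0].

End OperatorMatrices.

Definition vector_state (psi : H) (X : H -> H) : R[i] := ip (X psi) psi.

(* Exact embezzlement of \sum_i alpha_i e_i (x) e_i, entering through its
   Schmidt coefficients alpha; hd provides the index 0 of 'I_d. *)
Section Embezzlement.
Variables (d : nat) (hd : (1 < d)%N) (alpha : 'I_d -> R).

Let o : 'I_d := Ordinal (ltnW hd).

Definition embezzles_monopartite (M : set (H -> H)) (A : 'M[H -> H]_d)
    (psi : H) :=
  [/\ entries_in M A, contraction A, `|psi| = 1 &
      forall X, M X -> forall i j,
        vector_state psi (adjoint (A i o) \o X \o A j o) =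
        (if i == j then (alpha i ^+ 2)%:C * vector_state psi X else 0)].

Definition embezzles_bipartite (M M' : set (H -> H)) (A B : 'M[H -> H]_d)
    (psi : H) :=
  [/\ entries_in M A /\ contraction A, entries_in M' B /\ contraction B,
      `|psi| = 1 &
      act_left A (act_right B (basis_tensor o psi o)) =
      \sum_i (alpha i)%:C *: basis_tensor i psi i].

End Embezzlement.
End HilbertSpace.

(* Main.v *)
Require Import Defs.
From HB Require Import structures.
From mathcomp Require Import all_boot all_order all_algebra.
From mathcomp Require Import all_classical all_reals all_analysis.
From mathcomp Require Import sesquilinear complex.
From mathcomp Require Import ring lra.

Set Implicit Arguments.
Unset Strict Implicit.
Unset Printing Implicit Defensive.

Import Order.TTheory GRing.Theory Num.Theory.
Import numFieldNormedType.Exports.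

Local Open Scope classical_set_scope.
Local Open Scope complex_scope.
Local Open Scope ring_scope.

(* Write [r i] for the first column of the embezzling contraction and let [p] be
   the projection onto the common kernel of all operators of [M] that annihilate
   [psi], so that [psi] is separating for [p M p]. The compressions
   [s i = p (r i) p] satisfy [s i psi = r i psi]; a contraction which attains its
   norm at a separating vector is isometric, so [\sum_i s_i^* s_i = p]. The
   embezzlement condition then gives [\sum_i alpha_i^2 |s_i^* psi|^2 = 1], which
   forces [s_k s_i^* psi = delta_ki psi], hence [s_k s_i^* = delta_ki p]: the
   adjoints [s_i^*] are Cuntz isometries of [p M p]. Compressing further by
   [v = s_0^*] leaves enough room in the complement to extend the column
   [v s_i v^*] to a unitary, a product of two self-adjoint unitaries, which
   embezzles with the catalyst [v psi].

   In the bipartite case the norms in the defining equation can only match if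
   [R_i psi = alpha_i T_i^* psi]. Both columns then embezzle in the monopartite
   sense, and the two unitaries work together on the catalyst [v v' psi]. *)

(** * Hilbert spaces *)

Section HilbertSpaceTheory.
Context {R : realType} {H : completeNormedModType R[i]}.
Variable ip : {dot H for (@Num.conj R[i])}.
Hypothesis ip_norm : hilbert_norm ip.
Implicit Types (x y z : H) (a b : H -> H).

Definition rnorm x : R := complex.Re `|x|.

Lemma rnormE x : `|x| = (rnorm x)%:C.
Proof. by rewrite /rnorm RRe_real // normr_real. Qed.

Lemma rnorm_ge0 x : 0 <= rnorm x.
Proof. by rewrite -ler0c -rnormE. Qed.

Lemma rnorm_eq0 x : rnorm x = 0 -> x = 0.
Proof. by move=> x0; apply/normr0_eq0; rewrite rnormE x0. Qed.

Lemma rnormD x y : rnorm (x + y) <= rnorm x + rnorm y.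
Proof. by have := ler_normD x y; rewrite !rnormE -rmorphD lecR. Qed.

Lemma ip_self x : ip x x = (rnorm x ^+ 2)%:C.
Proof. by rewrite -ip_norm rnormE rmorphXn. Qed.

Lemma ipC x y : ip x y = (ip y x)^*.
Proof. by rewrite hermC expr0 mul1r. Qed.

Lemma ipDl z : {morph (fun x => ip x z) : x y / x + y}.
Proof. by move=> x y; rewrite linearDl. Qed.
Lemma ipDr z : {morph ip z : x y / x + y}.
Proof. by move=> x y; rewrite linearDr. Qed.
Lemma ipNl x z : ip (- x) z = - ip x z.
Proof. by rewrite linearNl. Qed.
Lemma ipNr x z : ip z (- x) = - ip z x.
Proof. by rewrite linearNr. Qed.
Lemma ipZl k x z : ip (k *: x) z = k * ip x z.
Proof. by rewrite linearZl_LR. Qed.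
Lemma ipZr k x z : ip z (k *: x) = k^* * ip z x.
Proof. by rewrite linearZr_LR. Qed.
Lemma ip0l z : ip 0 z = 0.
Proof. by rewrite linear0l. Qed.
Lemma ip0r z : ip z 0 = 0.
Proof. by rewrite linear0r. Qed.

Lemma ip_suml I (r : seq I) (P : pred I) (F : I -> H) z :
  ip (\sum_(i <- r | P i) F i) z = \sum_(i <- r | P i) ip (F i) z.
Proof. by rewrite linear_sumlz. Qed.

Lemma ip_sumr I (r : seq I) (P : pred I) (F : I -> H) z :
  ip z (\sum_(i <- r | P i) F i) = \sum_(i <- r | P i) ip z (F i).
Proof. by rewrite linear_sumr. Qed.

Lemma rnorm_sqD x y :
  rnorm (x + y) ^+ 2 = rnorm x ^+ 2 + rnorm y ^+ 2 + 2 * complex.Re (ip x y).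
Proof.
have : ip (x + y) (x + y) = ip x x + ip y y + (ip x y + (ip x y)^*).
  by rewrite ipDl !ipDr -ipC; ring.
rewrite !ip_self => /(congr1 (@complex.Re R)).
rewrite !raddfD /= => ->; case: (ip x y) => u v /=; ring.
Qed.

Lemma normc_sq (k : R[i]) :
  complex.Re `|k| ^+ 2 = complex.Re k ^+ 2 + complex.Im k ^+ 2.
Proof. by rewrite normc_def /= sqr_sqrtr ?addr_ge0 ?sqr_ge0. Qed.

Lemma rnormZ (k : R[i]) x : rnorm (k *: x) = complex.Re `|k| * rnorm x.
Proof. by rewrite /rnorm normrZ rnormE normc_def /= mul0r subr0. Qed.

Lemma rnormN x : rnorm (- x) = rnorm x.
Proof. by rewrite /rnorm normrN. Qed.

Lemma parallelogram x y :
  rnorm (x + y) ^+ 2 + rnorm (x - y) ^+ 2 =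
  2 * rnorm x ^+ 2 + 2 * rnorm y ^+ 2.
Proof. by rewrite !rnorm_sqD rnormN ipNr raddfN /=; ring. Qed.

(** * Minimal norm and orthogonal projection *)

Definition rclosed (C : set H) := forall x,
  (forall e : R, 0 < e -> exists2 y, C y & rnorm (x - y) < e) -> C x.

Lemma rnorm_complete (u : nat -> H) :
  (forall e : R, 0 < e -> exists N, forall n, (N <= n)%N ->
     rnorm (u N - u n) < e) ->
  exists z, forall e : R, 0 < e -> exists N, forall n, (N <= n)%N ->
     rnorm (z - u n) < e.
Proof.
move=> uC.
have toR (e : R[i]) : 0 < e -> 0 < complex.Re e /\ e = (complex.Re e)%:C.
  by case: e => a b; rewrite ltcE /= => /andP[/eqP -> ?].
have cu : cauchy (u @ \oo).
  apply: cauchy_exP => e /toR[e0 ->]; have [N uN] := uC _ e0.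
  exists (u N); exists N => // n Nn.
  by rewrite /= -ball_normE /ball_ /= rnormE ltcR uN.
have /cvg_ex[z uz] : cvg (u @ \oo) by exact: cauchy_cvg cu.
exists z => e e0.
have e0' : 0 < (e%:C : R[i]) by rewrite ltcR.
have /cvgrPdist_lt/(_ _ e0')[N _ uN] := uz.
by exists N => n Nn; have := uN n Nn; rewrite /= rnormE ltcR.
Qed.

(** The midpoint of two nearly minimal elements lies in [C], so the parallelogram law forces them to
    be close: a minimizing sequence is Cauchy, and its limit is the required element. *)
Lemma exists_min_norm (C : set H) : C !=set0 ->
  (forall x y, C x -> C y -> C (2^-1 *: (x + y))) -> rclosed C ->
  exists2 z, C z & forall y, C y -> rnorm z <= rnorm y.
Proof.
move=> [x0 Cx0] Cmid Ccl.
pose D := [set rnorm y | y in C]; pose m := inf D.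
have hD : has_inf D.
  split; first by exists (rnorm x0), x0.
  by exists 0 => _ [y _ <-]; apply: rnorm_ge0.
have mle y : C y -> m <= rnorm y.
  by move=> Cy; apply: ge_inf; [exact: hD.2|exists y].
have m0 : 0 <= m by apply: lb_le_inf hD.1 _ => _ [y _ <-]; apply: rnorm_ge0.
have uE (n : nat) : exists y, C y /\ rnorm y < m + n.+1%:R^-1.
  have [|_ [y Cy <-] ylt] := @inf_adherent R D n.+1%:R^-1 _ hD.
    by rewrite invr_gt0 ltr0n.
  by exists y.
have [u uP] := choice uE.
have Nsmall (e : R) : 0 < e -> exists N : nat, N.+1%:R^-1 < e.
  move=> e0; exists (Num.truncn (e^-1)).
  by rewrite invf_plt ?posrE ?ltr0n// ?truncnS_gt.
(* Put [s = k.+1%:R^-1]. Both norms are below [m + s] and the midpoint has norm at least [m], so the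
   left side is at most [4 (m + s)^2 - 4 m^2], and [s <= 1] gives the constant [8 m + 4]. *)
have dist k l : (k <= l)%N ->
    rnorm (u k - u l) ^+ 2 <= (8 * m + 4) * k.+1%:R^-1.
  move=> kl; have := parallelogram (u k) (u l).
  have [Cuk] := uP k; have [Cul] := uP l.
  have := mle _ (Cmid _ _ Cuk Cul); rewrite rnormZ.
  rewrite normfV normr_nat.
  have -> : complex.Re (2%:R^-1 : R[i]) = 2^-1.
    by rewrite -(rmorph_nat (real_complex R)) -fmorphV.
  have : l.+1%:R^-1 <= k.+1%:R^-1 :> R.
    by rewrite lef_pV2 ?posrE ?ltr0n// ler_nat.
  have : k.+1%:R^-1 <= 1 :> R by rewrite invf_le1 ?ltr0n// ler1n.
  have : 0 < k.+1%:R^-1 :> R by rewrite invr_gt0 ltr0n.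
  move: (k.+1%:R^-1) (l.+1%:R^-1) => s t.
  have := rnorm_ge0 (u k); have := rnorm_ge0 (u l).
  have := rnorm_ge0 (u k + u l).
  move: (rnorm (u k)) (rnorm (u l)) (rnorm (u k + u l)) => p q r.
  move=> r0 q0 p0 s0 s1 ts mr qt ps par.
  have mr2 : (2 * m) ^+ 2 <= r ^+ 2 by rewrite ler_pXn2r ?nnegrE//; lra.
  have ps2 : p ^+ 2 <= (m + s) ^+ 2 by rewrite ler_pXn2r ?nnegrE//; lra.
  have qs2 : q ^+ 2 <= (m + s) ^+ 2 by rewrite ler_pXn2r ?nnegrE//; lra.
  have ss : s ^+ 2 <= s by rewrite expr2 ler_piMl// ltW.
  lra.
have [] := @rnorm_complete u.
  move=> e e0; have [|N Ne] := Nsmall (e ^+ 2 / (8 * m + 4)).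
    by apply: divr_gt0; [apply: exprn_gt0|lra].
  exists N => n Nn; rewrite -(@ltr_pXn2r _ 2) ?nnegrE ?rnorm_ge0 ?ltW//.
  apply: le_lt_trans (dist _ _ Nn) _; rewrite mulrC -ltr_pdivlMr//; lra.
move=> z uz; exists z.
  apply: Ccl => e /uz[N uN]; exists (u N); first exact: (uP N).1.
  exact: uN.
move=> y Cy; apply: le_trans (mle _ Cy); rewrite leNgt; apply/negP => mz.
pose e : R := rnorm z - m.
have e2 : 0 < e / 2 by rewrite divr_gt0// subr_gt0.
have [N1 h1] := uz _ e2; have [N2 h2] := Nsmall _ e2.
pose n := maxn N1 N2; have := h1 n (leq_maxl _ _).
have [_] := uP n; have := rnormD (z - u n) (u n); rewrite subrK.
have : n.+1%:R^-1 <= N2.+1%:R^-1 :> R.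
  by rewrite lef_pV2 ?posrE ?ltr0n// ler_nat ltnS leq_maxr.
by move: h2; rewrite /e; move: n.+1%:R^-1 N2.+1%:R^-1 => s t *; lra.
Qed.

Definition complex_subspace (K : set H) :=
  forall (k : R[i]) x y, K x -> K y -> K (k *: x + y).

(** The shortest [z] with [x - z] in [K] is orthogonal to [K]: otherwise a small move along some [k]
    in [K] would shorten it. *)
Lemma projection_exists (K : set H) : K 0 -> complex_subspace K -> rclosed K ->
  forall x, exists2 y, K y & forall k, K k -> ip (x - y) k = 0.
Proof.
move=> K0 Ksub Kcl x.
have KD y z : K y -> K z -> K (y + z).
  by move=> Ky Kz; rewrite -[y]scale1r; apply: Ksub.
have KZ c y : K y -> K (c *: y).
  by move=> Ky; rewrite -[_ *: _]addr0; apply: Ksub.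
pose C := [set z | K (x - z)].
have [|||z Cz zmin] := @exists_min_norm C.
- by exists x; rewrite /C /= subrr.
- move=> y z Cy Cz; rewrite /C /=.
  have -> : x - 2^-1 *: (y + z) = 2^-1 *: ((x - y) + (x - z)).
    rewrite addrACA -opprD scalerBr; congr (_ - _).
    by rewrite -mulr2n -(scaler_nat _ x) scalerA mulVf ?scale1r ?pnatr_eq0.
  exact/KZ/KD.
- move=> u ucl; apply: Kcl => e /ucl[y Cy uy]; exists (x - y) => //.
  by rewrite opprB addrC addrA subrK -rnormN opprB.
exists (x - z); first exact: Cz.
move=> k Kk; rewrite subKr; apply/eqP/negPn/negP => a0.
set a := ip z k in a0 *.
have ak0 : 0 < complex.Re a ^+ 2 + complex.Im a ^+ 2.
  rewrite lt_neqAle addr_ge0 ?sqr_ge0// andbT eq_sym paddr_eq0 ?sqr_ge0//.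
  by rewrite !sqrf_eq0; move: a0; rewrite eq_complex.
(* Subtracting [c a k] from [z] changes the squared norm by [- c |a|^2 (2 - c |k|^2)]. The summand 1
   keeps the denominator positive and [c |k|^2] below 1. *)
pose c : R := (rnorm k ^+ 2 + 1)^-1.
have k1 : 0 < rnorm k ^+ 2 + 1 by have := sqr_ge0 (rnorm k); lra.
have c0 : 0 < c by rewrite invr_gt0.
have ck : c * rnorm k ^+ 2 < 1.
  by rewrite mulrC ltr_pdivrMr// mul1r ltrDl.
clearbody c; have : rnorm z <= rnorm (z + (- c%:C * a) *: k).
  apply: zmin; rewrite /C /= opprD addrA -scaleNr.
  by apply: KD => //; apply: KZ.
rewrite -(@ler_pXn2r _ 2) ?nnegrE ?rnorm_ge0// rnorm_sqD ipZr -/a rnormZ.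
rewrite exprMn normc_sq; move: ak0 (rnorm k ^+ 2) ck; case: a {a0} => u v /=.
move=> uv0 n cn.
have : 0 < c * (u ^+ 2 + v ^+ 2) * (2 - c * n) by rewrite !mulr_gt0//; lra.
lra.
Qed.

End HilbertSpaceTheory.

(** * Adjoints and commutants *)

Section BoundedOperators.
Context {R : realType} {H : completeNormedModType R[i]}.
Variable ip : {dot H for (@Num.conj R[i])}.
Hypothesis ip_norm : hilbert_norm ip.
Implicit Types (x y z : H) (a b : H -> H).

Lemma normc_eq0 (k : R[i]) : complex.Re `|k| = 0 <-> k = 0.
Proof.
split=> [k0|->]; last by rewrite normr0.
by apply/normr0_eq0/eqP; rewrite eq_complex k0 normc_def /= !eqxx.
Qed.

Lemma cauchy_schwarz x y : complex.Re `|ip x y| <= rnorm x * rnorm y.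
Proof.
have [->|y0] := eqVneq y 0.
  by rewrite ip0r normr0 mulr_ge0 ?rnorm_ge0.
have N0 : 0 < rnorm y ^+ 2.
  rewrite exprn_gt0// lt_neqAle rnorm_ge0 andbT eq_sym.
  by apply: contra_neq y0; apply: rnorm_eq0.
have re0 : 0 <= complex.Re `|ip x y| by rewrite normc_def /= sqrtr_ge0.
rewrite -(@ler_pXn2r _ 2) ?nnegrE ?mulr_ge0 ?rnorm_ge0// exprMn normc_sq.
set c : R := (rnorm y ^+ 2)^-1.
(* This vector is [x] minus its component along [y]. *)
have := sqr_ge0 (rnorm (x + (- c%:C * ip x y) *: y)).
rewrite (rnorm_sqD ip_norm) ipZr rnormZ exprMn normc_sq.
have cN : c * rnorm y ^+ 2 = 1 by rewrite mulVf ?gt_eqF.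
have : 0 < c by rewrite invr_gt0.
move: N0 cN; rewrite {re0}; clearbody c; case: (ip x y) => u v /=.
move: (rnorm x ^+ 2) (rnorm y ^+ 2) => n m m0 cm c0 h.
have {h} : 0 <= n + c * (c * m) * (u ^+ 2 + v ^+ 2) - 2 * c * (u ^+ 2 + v ^+ 2).
  by move: h; congr (_ <= _); ring.
have -> : n + c * (c * m) * (u ^+ 2 + v ^+ 2) - 2 * c * (u ^+ 2 + v ^+ 2) =
  n - c * (u ^+ 2 + v ^+ 2) by rewrite cm; ring.
rewrite -(pmulr_rge0 _ m0) mulrBr mulrA [m * c]mulrC cm; lra.
Qed.

Lemma ip_extr y z : (forall x, ip x y = ip x z) -> y = z.
Proof.
move=> yz; apply/eqP; rewrite -subr_eq0; apply/eqP/rnorm_eq0.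
have : ip (y - z) (y - z) = 0 by rewrite ipDr ipNr yz subrr.
by rewrite (ip_self ip_norm) => -[/eqP]; rewrite sqrf_eq0 => /eqP.
Qed.

Lemma bounded_rnorm a : bounded_operator a ->
  exists2 k : R, 0 <= k & forall x, rnorm (a x) <= k * rnorm x.
Proof.
move=> [_ [[k k'] ak]]; exists `|k| => // x.
have := ak x; rewrite !rnormE lecE => /andP[_] /=.
rewrite mulr0 subr0 => /le_trans; apply.
by rewrite ler_wpM2r ?rnorm_ge0 ?ler_norm.
Qed.

Lemma rnorm_bounded a (k : R) : linear a ->
  (forall x, rnorm (a x) <= k * rnorm x) -> bounded_operator a.
Proof.
by move=> la ak; split=> //; exists k%:C => x; rewrite !rnormE -rmorphM lecR.
Qed.

Section BoundedOperator.
Variable a : H -> H.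
Hypothesis ba : bounded_operator a.

Lemma boundedD x y : a (x + y) = a x + a y.
Proof. by have := ba.1 1 x y; rewrite !scale1r. Qed.

Lemma bounded0 : a 0 = 0.
Proof. by apply: (@addrI _ (a 0)); rewrite -boundedD !addr0. Qed.

Lemma boundedZ k x : a (k *: x) = k *: a x.
Proof. by have := ba.1 k x 0; rewrite bounded0 !addr0. Qed.

Lemma boundedN x : a (- x) = - a x.
Proof. by rewrite -scaleN1r boundedZ scaleN1r. Qed.

Lemma boundedB x y : a (x - y) = a x - a y.
Proof. by rewrite boundedD boundedN. Qed.

Lemma bounded_sum I (r : seq I) (P : pred I) (F : I -> H) :
  a (\sum_(i <- r | P i) F i) = \sum_(i <- r | P i) a (F i).
Proof. by apply: (big_morph a boundedD bounded0). Qed.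

End BoundedOperator.

(** With [g] the modulus of a bounded functional, or the norm of the values of a bounded operator,
    this gives closed kernels. *)
Lemma rclosed_zero (g : H -> R) (k : R) : (forall x, 0 <= g x) ->
  (forall x y, g y = 0 -> g x <= k * rnorm (x - y)) ->
  rclosed [set x | g x = 0].
Proof.
move=> g0 gk x xcl; apply/eqP; rewrite eq_le g0 andbT leNgt.
apply/negP => gx.
have k1 : 0 < `|k| + 1 by rewrite ltr_wpDl.
have [|y /= gy lt1] := xcl (g x / (`|k| + 1)); first by rewrite divr_gt0.
have le1 := gk x y gy.
move: lt1; rewrite ltr_pdivlMr// ltNge => /negP; apply.
apply: le_trans le1 _; rewrite mulrC ler_wpM2l ?rnorm_ge0//.
by have := ler_norm k; lra.
Qed.

(** Riesz representation of the functional [f x = ip (a x) y]: a nonzero vector orthogonal to its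
    kernel represents [f] up to a scalar. *)
Lemma adjoint_exists a : bounded_operator a -> exists b, is_adjoint ip a b.
Proof.
move=> ba.
suff /choice[b bP] : forall y, exists z, forall x, ip (a x) y = ip x z.
  by exists b => x y; apply: bP.
move=> y; pose f x := ip (a x) y.
have fP k u v : f (k *: u + v) = k * f u + f v.
  by rewrite /f (boundedD ba) (boundedZ ba) ipDl ipZl.
pose K := [set x | f x = 0].
have [[x0 fx0]|] := pselect (exists x, f x != 0); last first.
  move=> f0; exists 0 => x; rewrite ip0r; apply/eqP/negPn/negP => fx.
  by apply: f0; exists x.
have KL (k : R[i]) u v : K u -> K v -> K (k *: u + v).
  by rewrite /K /= fP => -> ->; rewrite mulr0 addr0.
have [m m0 am] := bounded_rnorm ba.
have Kcl : rclosed K.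
  have -> : K = [set x | complex.Re `|f x| = 0].
    by apply/seteqP; split=> x /normc_eq0.
  apply: (@rclosed_zero _ (m * rnorm y)) => [x|u v fv].
    by rewrite normc_def /= sqrtr_ge0.
  move/normc_eq0: fv => fv.
  have -> : f u = ip (a (u - v)) y.
    by rewrite (boundedB ba) ipDl ipNl -/(f v) fv oppr0 addr0.
  apply: le_trans (cauchy_schwarz _ _) _.
  by rewrite mulrAC ler_wpM2r ?rnorm_ge0.
have [|w Kw wP] := projection_exists ip_norm _ KL Kcl x0.
  by rewrite /K /= /f (bounded0 ba) ip0l.
have fw : ip (a w) y = 0 := Kw.
pose z := x0 - w.
have fz : f z != 0 by rewrite /f /z (boundedB ba) ipDl ipNl fw oppr0 addr0.
have zz : ip z z != 0.
  apply: contra_neq fz; rewrite (ip_self ip_norm) => -[/eqP].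
  by rewrite sqrf_eq0 => /eqP/rnorm_eq0 ->; rewrite /f (bounded0 ba) ip0l.
(* The vector [x - (f x / f z) z] lies in the kernel of [f] and so is orthogonal to [z], which
   determines the scalar. The conjugate is there because [ip] is conjugate-linear in its second
   variable. *)
exists ((f z / ip z z)^* *: z) => x.
have : K (- (f x / f z) *: z + x).
  by rewrite /K /= fP mulNr divfK// addNr.
move/wP; rewrite -/z ipC ipDl ipZl => /(congr1 (@Num.conj R[i])).
rewrite conjCK conjC0 mulNr => /eqP; rewrite addrC subr_eq0 => /eqP xz.
by rewrite ipZr conjCK xz -/(f x); field; rewrite fz.
Qed.

Lemma adjointP a : bounded_operator a -> is_adjoint ip a (adjoint ip a).
Proof.
by move=> /adjoint_exists[b ab]; apply: (xgetPex _ (ex_intro _ b ab)).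
Qed.

Lemma is_adjoint_sym a b : is_adjoint ip a b -> is_adjoint ip b a.
Proof. by move=> ab x y; rewrite ipC -ab -ipC. Qed.

Lemma is_adjoint_inj a b b' : is_adjoint ip a b -> is_adjoint ip a b' -> b = b'.
Proof.
by move=> ab ab'; apply/funext => y; apply: ip_extr => x; rewrite -ab ab'.
Qed.

Lemma adjoint_unique a b : is_adjoint ip a b -> adjoint ip a = b.
Proof.
move=> ab; apply: is_adjoint_inj (ab).
exact: (xgetPex _ (ex_intro _ b ab)).
Qed.

(** Since [|b x|^2 = ip (a (b x)) x], Cauchy-Schwarz hands the bound of [a] over to [b]. *)
Lemma is_adjoint_bounded a b :
  bounded_operator a -> is_adjoint ip a b -> bounded_operator b.
Proof.
move=> ba ab; have [k k0 ak] := bounded_rnorm ba.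
apply: (@rnorm_bounded _ k) => [c u v|x].
  by apply: ip_extr => x; rewrite -ab !ipDr !ipZr !ab.
have [b0|b0] := eqVneq (rnorm (b x)) 0; first by rewrite b0 mulr_ge0 ?rnorm_ge0.
have bx0 : 0 < rnorm (b x) by rewrite lt_neqAle eq_sym b0 rnorm_ge0.
rewrite -(ler_pM2l bx0) -expr2 mulrA [_ * k]mulrC.
have -> : rnorm (b x) ^+ 2 = complex.Re `|ip (a (b x)) x|.
  rewrite ab (ip_self ip_norm) normc_def /= expr0n addr0 sqrtr_sqr.
  by rewrite ger0_norm ?sqr_ge0.
apply: le_trans (cauchy_schwarz _ _) _.
by rewrite ler_wpM2r ?rnorm_ge0.
Qed.

Lemma adjoint_bounded a : bounded_operator a -> bounded_operator (adjoint ip a).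
Proof. by move=> ba; apply: is_adjoint_bounded (adjointP ba). Qed.

Lemma is_adjoint_comp a a' b b' : is_adjoint ip a a' -> is_adjoint ip b b' ->
  is_adjoint ip (a \o b) (b' \o a').
Proof. by move=> aa bb x y; rewrite /= aa bb. Qed.

(** * The commutant as a von Neumann algebra *)

Section Commutant.
Variable M : set (H -> H).
Hypothesis M_vna : von_neumann_algebra ip M.

(** This lets the bipartite case apply every result on [M] to its commutant too. Closure under
    adjoints comes from the adjoint of the commutation relation with [adjoint ip x]. *)
Lemma commutant_vna : von_neumann_algebra ip (commutant M).
Proof.
have Mb := vna_bounded M_vna.
have fE (a b : H -> H) x : (a + b) x = a x + b x by [].
split.
- by move=> a [].
- split=> //; apply: (@rnorm_bounded _ 1) => // x; by rewrite mul1r.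
- move=> a b [ba ca] [bb cb]; split.
    have [k k0 ak] := bounded_rnorm ba; have [l l0 bl] := bounded_rnorm bb.
    apply: (@rnorm_bounded _ (k + l)) => [c u v|x].
      rewrite !fE !(boundedD ba) !(boundedD bb) (boundedZ ba) (boundedZ bb).
      by rewrite scalerDr addrACA.
    by apply: le_trans (rnormD _ _) _; rewrite mulrDl lerD.
  move=> x Mx; apply/funext => y /=; rewrite !fE (boundedD (Mb _ Mx)).
  congr (_ + _); first exact: (congr1 (fun f => f y) (ca _ Mx)).
  exact: (congr1 (fun f => f y) (cb _ Mx)).
- move=> c a [ba ca]; split.
    have [k k0 ak] := bounded_rnorm ba.
    apply: (@rnorm_bounded _ (complex.Re `|c| * k)) => [e u v|x].
      rewrite !fctE (boundedD ba) (boundedZ ba) scalerDr !scalerA.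
      by rewrite mulrC.
    by rewrite fctE rnormZ -mulrA ler_wpM2l// normc_def /= sqrtr_ge0.
  move=> x Mx; apply/funext => y /=; rewrite !fctE (boundedZ (Mb _ Mx)).
  by congr (_ *: _); apply: (congr1 (fun f => f y) (ca _ Mx)).
- move=> a b [ba ca] [bb cb]; split.
    have [k k0 ak] := bounded_rnorm ba; have [l l0 bl] := bounded_rnorm bb.
    apply: (@rnorm_bounded _ (k * l)) => [c u v|x] /=.
      by rewrite (boundedD bb) (boundedZ bb) (boundedD ba) (boundedZ ba).
    by apply: le_trans (ak _) _; rewrite -mulrA ler_wpM2l.
  move=> x Mx; rewrite -[RHS]compA -(cb _ Mx) [LHS]compA (ca _ Mx).
  by rewrite -[LHS]compA.
- move=> a [ba ca]; split; first exact: adjoint_bounded.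
  move=> x Mx.
  apply: (@is_adjoint_inj (a \o adjoint ip x)).
    have := is_adjoint_comp (adjointP ba) (is_adjoint_sym (adjointP (Mb _ Mx))).
    by [].
  rewrite -(ca _ (vna_adjoint M_vna Mx)).
  exact: is_adjoint_comp (is_adjoint_sym (adjointP (Mb _ Mx))) (adjointP ba).
- by rewrite (vna_bicommutant M_vna).
Qed.

End Commutant.

End BoundedOperators.

(** * Unitaries from Cuntz relations *)

Section StarRing.
Variables (A : pzRingType) (st : A -> A).
Hypothesis stK : involutive st.
Hypothesis stD : {morph st : x y / x + y}.
Hypothesis stM : forall x y, st (x * y) = st y * st x.
Variables (d : nat) (o : 'I_d).
Implicit Types (x y : A) (X Y : 'M[A]_d).

Lemma star0 : st 0 = 0.
Proof. by apply: (@addrI _ (st 0)); rewrite -stD !addr0. Qed.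

Lemma starN x : st (- x) = - st x.
Proof. by apply: (@addrI _ (st x)); rewrite -stD !subrr star0. Qed.

Lemma star1 : st 1 = 1.
Proof. by rewrite -[st 1]mul1r -{1}[1]stK -stM mul1r stK. Qed.

Lemma star_sum I (r : seq I) (P : pred I) (F : I -> A) :
  st (\sum_(i <- r | P i) F i) = \sum_(i <- r | P i) st (F i).
Proof. exact: (big_morph st stD star0). Qed.

Definition starmx X : 'M[A]_d := \matrix_(i, j) st (X j i).

Lemma starmxK : involutive starmx.
Proof. by move=> X; apply/matrixP => i j; rewrite !mxE stK. Qed.

Lemma starmxD : {morph starmx : X Y / X + Y}.
Proof. by move=> X Y; apply/matrixP => i j; rewrite !mxE stD. Qed.

Lemma starmxN : {morph starmx : X / - X}.
Proof. by move=> X; apply/matrixP => i j; rewrite !mxE starN. Qed.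

Lemma starmxM X Y : starmx (X * Y) = starmx Y * starmx X.
Proof.
apply/matrixP => i j; rewrite !mxE star_sum; apply: eq_bigr => k _.
by rewrite stM !mxE.
Qed.

Lemma starmx1 : starmx 1 = 1.
Proof.
by apply/matrixP => i j; rewrite !mxE eq_sym; case: eqP; rewrite ?star1 ?star0.
Qed.

(** Think of [z] as the adjoint of a partial isometry [y] whose initial and final projections
    [z * y] and [y * z] are orthogonal. The element exchanges their ranges through [y + z] and is
    the identity elsewhere. *)
Lemma partial_isometry_swap (B : pzRingType) (y z : B) :
  y * y = 0 -> z * z = 0 -> y * z * y = y -> z * y * z = z ->
  (1 - y * z - z * y + y + z) ^+ 2 = 1.
Proof.
move=> yy zz yzy zyz; pose K := y + z; pose P := y * z + z * y.
have KK : K * K = P by rewrite /K mulrDl !mulrDr yy zz add0r addr0.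
have KP : K * P = K.
  by rewrite /K /P mulrDl !mulrDr !mulrA yy zz yzy zyz !mul0r add0r addr0.
have PK : P * K = K by rewrite -KK -mulrA KK KP.
have PP : P * P = P by rewrite -{1}KK -mulrA KP.
have -> : 1 - y * z - z * y + y + z = 1 - P + K.
  by rewrite /P /K opprD !addrA.
clearbody K P; have QQ : (1 - P) * (1 - P) = 1 - P.
  by rewrite mulrBr mulr1 mulrBl mul1r PP subrr subr0.
have QK : (1 - P) * K = 0 by rewrite mulrBl mul1r PK subrr.
have KQ : K * (1 - P) = 0 by rewrite mulrBr mulr1 KP subrr.
move: (1 - P) (subrK P 1) QQ QK KQ => Q QP QQ QK KQ.
by rewrite expr2 mulrDl !mulrDr QQ QK KQ KK addr0 add0r.
Qed.

Section ColumnSwap.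
Variable c : 'I_d -> A.
Let e := \sum_k st (c k) * c k.
Hypothesis c_mul0 : forall i, c i * c o = 0.
Hypothesis c_mul_e : forall i, c i * e = c i.

(** Placed in column [o] of a matrix [Y], the [c i] form a partial isometry with initial projection
    [e] in the summand [o]; the vanishing products [c i * c o] give [Y * Y = 0]. Then [G] is the
    swap attached to [Y]. *)
Lemma column_swap : exists G : 'M[A]_d,
  [/\ starmx G = G, G * G = 1 & forall i, G i o * e = c i].
Proof.
pose Y : 'M[A]_d := \matrix_(i, j) (if j == o then c i else 0).
pose Z := starmx Y.
have YM X i j : (Y * X) i j = c i * X o j.
  rewrite mxE (bigD1 o)//= big1 ?addr0 => [|k ko]; rewrite mxE ?eqxx//.
  by rewrite (negPf ko) mul0r.
have ZY i j : (Z * Y) i j = if (i == o) && (j == o) then e else 0.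
  rewrite mxE; case: ifP => [/andP[/eqP-> /eqP->]|ij].
    by apply: eq_bigr => k _; rewrite !mxE eqxx.
  apply: big1 => k _; rewrite !mxE.
  by case: eqP ij => //= _; rewrite ?star0 ?mul0r// => ->; rewrite mulr0.
have YY0 : Y * Y = 0.
  apply/matrixP => i j; rewrite YM !mxE; case: ifP => _; last exact: mulr0.
  exact: c_mul0.
have YZY : Y * Z * Y = Y.
  rewrite -mulrA; apply/matrixP => i j; rewrite YM ZY mxE eqxx /=.
  by case: ifP => _; rewrite ?c_mul_e ?mulr0.
have ZZ0 : Z * Z = 0.
  by rewrite -starmxM YY0; apply/matrixP => i j; rewrite !mxE star0.
have ZYZ : Z * Y * Z = Z.
  by rewrite -mulrA -{1}[Y]starmxK -!starmxM YZY.
exists (1 - Y * Z - Z * Y + Y + Z); split.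
- rewrite !starmxD !starmxN !starmxM starmx1 starmxK -/Z.
  by rewrite -!addrA; congr (_ + (_ + (_ + _))); rewrite addrC.
- by rewrite -expr2 partial_isometry_swap.
(* This removes the contributions of [Y * Z] and [Z] to column [o] of [G]; those of [1] and [Z * Y]
   cancel. *)
move=> i; have se : st (c o) * e = 0.
  rewrite mulr_sumr big1// => k _.
  by rewrite mulrA -stM c_mul0 star0 mul0r.
have ee : e * e = e.
  by rewrite {1}/e mulr_suml; apply: eq_bigr => k _; rewrite -mulrA c_mul_e.
have -> : (1 - Y * Z - Z * Y + Y + Z) i o =
  (1 : 'M[A]_d) i o - (Y * Z) i o - (Z * Y) i o + Y i o + Z i o by rewrite !mxE.
rewrite YM ZY !mxE !eqxx andbT !mulrDl !mulNr -mulrA se mulr0 subr0 c_mul_e.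
case: eqP => _ /=.
  by rewrite mul1r ee subrr add0r se addr0.
by rewrite star0 !mul0r subrr add0r addr0.
Qed.

End ColumnSwap.

(** With [v = st (s o)], the column [v * s i * st v] starts on the range of [v] in the summand [o],
    and its own range contains that space, so one swap cannot produce it. The range of [st (s l)] is
    orthogonal to that of [v], and a detour through it splits the column into two swaps. *)
Lemma cuntz_unitary (s : 'I_d -> A) (p : A) (l : 'I_d) : l != o ->
  (forall i, p * s i = s i) -> (forall i, s i * p = s i) ->
  (forall i j, s i * st (s j) = if i == j then p else 0) ->
  \sum_k st (s k) * s k = p ->
  exists U : 'M[A]_d, [/\ starmx U * U = 1, U * starmx U = 1 &
    forall i, U i o * st (s o) = st (s o) * s i].
Proof.
move=> lo ps sp ss sum_p.
have ol : (o == l) = false by rewrite eq_sym (negPf lo).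
have pst : st p = p.
  by rewrite -sum_p star_sum; apply: eq_bigr => k _; rewrite stM stK.
have tp i : st (s i) * p = st (s i) by rewrite -{1}pst -stM ps.
pose f i := if i == o then st (s l) * s o else 0.
pose c i := st (s o) * s i * s l.
have ef : \sum_k st (f k) * f k = st (s o) * s o.
  rewrite (bigD1 o)//= big1 ?addr0 => [|k ko]; last first.
    by rewrite /f (negPf ko) mulr0.
  by rewrite /f eqxx stM stK mulrA -[_ * st (s l)]mulrA ss eqxx tp.
have ec : \sum_k st (c k) * c k = st (s l) * s l.
  transitivity (st (s l) * (\sum_k st (s k) * s k) * s l).
    rewrite mulr_sumr mulr_suml; apply: eq_bigr => k _.
    rewrite /c !stM stK !mulrA -[_ * s o * st (s o)]mulrA ss eqxx.
    by rewrite -[_ * st (s k) * p]mulrA tp.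
  by rewrite sum_p tp.
have [||F [Fs FF Fo]] := @column_swap f.
- move=> i; rewrite /f eqxx; case: ifP => _; last by rewrite mul0r.
  by rewrite mulrA -[_ * s o * _]mulrA ss ol mulr0 mul0r.
- move=> i; rewrite ef /f; case: ifP => _; last by rewrite mul0r.
  by rewrite mulrA -[_ * s o * _]mulrA ss eqxx tp.
have [||G [Gs GG Go]] := @column_swap c.
- move=> i; rewrite /c !mulrA -[_ * s l * _]mulrA ss (negPf lo).
  by rewrite mulr0 !mul0r.
- by move=> i; rewrite ec /c !mulrA -[_ * s l * _]mulrA ss eqxx -!mulrA ps.
(* [F] exchanges the ranges of [s o]^* and [s l]^* in the summand [o]; [G]
   exchanges the latter with the sum of the copies of the former. *)
exists (G * F); rewrite starmxM Fs Gs; split.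
- by rewrite mulrA -[F * G * G]mulrA GG mulr1 FF.
- by rewrite mulrA -[G * F * F]mulrA FF mulr1 GG.
have Fc k : F k o * st (s o) = if k == o then st (s l) else 0.
  have -> : st (s o) = st (s o) * s o * st (s o) by rewrite -mulrA ss eqxx tp.
  rewrite -ef mulrA Fo /f; case: eqP => _; last exact: mul0r.
  by rewrite -mulrA ss eqxx tp.
move=> i; rewrite mxE mulr_suml (bigD1 o)//= big1 ?addr0 => [|k ko]; last first.
  by rewrite -mulrA Fc (negPf ko) mulr0.
rewrite -mulrA Fc eqxx.
have -> : st (s l) = st (s l) * s l * st (s l) by rewrite -mulrA ss eqxx tp.
by rewrite -ec mulrA Go /c -mulrA ss eqxx -mulrA sp.
Qed.

End StarRing.

(** * The ring of operators of a von Neumann algebra *)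

Section OperatorRing.
Context {R : realType} {H : completeNormedModType R[i]}.
Variable ip : {dot H for (@Num.conj R[i])}.

(** Bundling an operator with its membership in [M] turns [M] into a ring with involution, so that
    matrices over it form a ring and the purely algebraic construction of unitaries applies. *)
Record vn_op (M : set (H -> H)) (M_vna : von_neumann_algebra ip M) :=
  VnOp { vn_fun :> H -> H; vn_funP : M vn_fun }.

HB.instance Definition _ M M_vna := gen_eqMixin (@vn_op M M_vna).
HB.instance Definition _ M M_vna := gen_choiceMixin (@vn_op M M_vna).

Hypothesis ip_norm : hilbert_norm ip.
Variables (M : set (H -> H)) (M_vna : von_neumann_algebra ip M).
Local Notation op := (vn_op M_vna).
Implicit Types (x y z : op) (u v : H).

Lemma vn_bounded x : bounded_operator x.
Proof. exact: vna_bounded M_vna _ (vn_funP x). Qed.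

Lemma vn_op_ext x y : (forall u, x u = y u) -> x = y.
Proof.
case: x y => a Ma [b Mb] /= /funext ab; rewrite -{}ab in Mb *.
by rewrite (Prop_irrelevance Ma Mb).
Qed.

Lemma vn_opp_subproof x : M (- (x : H -> H)).
Proof.
have -> : - (x : H -> H) = (-1) *: (x : H -> H).
  by apply/funext => u; rewrite !fctE scaleN1r.
exact: (vna_scale M_vna _ (vn_funP x)).
Qed.

Lemma vn_zero_subproof : M 0.
Proof.
have -> : 0 = 0 *: (idfun : H -> H) by apply/funext => u; rewrite !fctE scale0r.
exact/(vna_scale M_vna)/(vna_id M_vna).
Qed.

Definition vn_add x y : op :=
  VnOp M_vna (vna_add M_vna (vn_funP x) (vn_funP y)).
Definition vn_opp x : op := VnOp M_vna (vn_opp_subproof x).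
Definition vn_zero : op := VnOp M_vna vn_zero_subproof.
Definition vn_one : op := VnOp M_vna (vna_id M_vna).
Definition vn_mul x y : op :=
  VnOp M_vna (vna_comp M_vna (vn_funP x) (vn_funP y)).
Definition vn_star x : op := VnOp M_vna (vna_adjoint M_vna (vn_funP x)).

Lemma vn_addA : associative vn_add.
Proof. by move=> x y z; apply: vn_op_ext => u; apply: addrA. Qed.
Lemma vn_addC : commutative vn_add.
Proof. by move=> x y; apply: vn_op_ext => u; apply: addrC. Qed.
Lemma vn_add0 : left_id vn_zero vn_add.
Proof. by move=> x; apply: vn_op_ext => u; apply: add0r. Qed.
Lemma vn_addN : left_inverse vn_zero vn_opp vn_add.
Proof. by move=> x; apply: vn_op_ext => u; apply: addNr. Qed.

HB.instance Definition _ :=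
  GRing.isZmodule.Build op vn_addA vn_addC vn_add0 vn_addN.

Lemma vn_mulA : associative vn_mul.
Proof. by move=> x y z; apply: vn_op_ext. Qed.
Lemma vn_mul1 : left_id vn_one vn_mul.
Proof. by move=> x; apply: vn_op_ext. Qed.
Lemma vn_mulr1 : right_id vn_one vn_mul.
Proof. by move=> x; apply: vn_op_ext. Qed.
Lemma vn_mulDl : left_distributive vn_mul +%R.
Proof. by move=> x y z; apply: vn_op_ext. Qed.
Lemma vn_mulDr : right_distributive vn_mul +%R.
Proof.
by move=> x y z; apply: vn_op_ext => u; apply: boundedD (vn_bounded x) _ _.
Qed.

HB.instance Definition _ := GRing.Zmodule_isPzRing.Build op
  vn_mulA vn_mul1 vn_mulr1 vn_mulDl vn_mulDr.

End OperatorRing.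

Section OperatorRingTheory.
Context {R : realType} {H : completeNormedModType R[i]}.
Variable ip : {dot H for (@Num.conj R[i])}.
Hypothesis ip_norm : hilbert_norm ip.
Variables (M : set (H -> H)) (M_vna : von_neumann_algebra ip M).
Local Notation op := (vn_op M_vna).
Implicit Types (x y z : op) (u v : H).

Lemma vn_addE x y u : (x + y) u = x u + y u. Proof. by []. Qed.
Lemma vn_oppE x u : (- x) u = - x u. Proof. by []. Qed.
Lemma vn_mulE x y u : (x * y) u = x (y u). Proof. by []. Qed.
Lemma vn_oneE u : (1 : op) u = u. Proof. by []. Qed.

Lemma vn_sumE I (r : seq I) (P : pred I) (F : I -> op) u :
  (\sum_(i <- r | P i) F i) u = \sum_(i <- r | P i) F i u.
Proof. by elim/big_ind2 : _ => // x v y w <- <-. Qed.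

Lemma vn_starP x : is_adjoint ip x (vn_star x).
Proof. exact/adjointP/vn_bounded. Qed.

Lemma vn_star_adjoint x : is_adjoint ip (vn_star x) x.
Proof. exact/is_adjoint_sym/vn_starP. Qed.

Lemma vn_star_unique x y : is_adjoint ip x y -> vn_star x = y.
Proof.
move=> xy; apply: vn_op_ext => u.
exact: (congr1 (fun f => f u) (adjoint_unique ip_norm xy)).
Qed.

Lemma vn_starK : involutive (@vn_star _ _ ip M M_vna).
Proof. by move=> x; apply/vn_star_unique/vn_star_adjoint. Qed.

Lemma vn_starD : {morph @vn_star _ _ ip M M_vna : x y / x + y}.
Proof.
move=> x y; apply: vn_star_unique => u v.
by rewrite !vn_addE ipDl ipDr !vn_starP.
Qed.

Lemma vn_starM x y : vn_star (x * y) = vn_star y * vn_star x.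
Proof. by apply: vn_star_unique => u v; rewrite !vn_mulE !vn_starP. Qed.

(** * Operator matrices as matrices over the ring *)

Section OperatorMatrices.
Variable d : nat.
Implicit Types X Y : 'M[op]_d.

Definition vn_mx X : 'M[H -> H]_d := \matrix_(i, j) (X i j : H -> H).

Lemma vn_mx_mul X Y : opmx_mul (vn_mx X) (vn_mx Y) = vn_mx (X * Y).
Proof.
apply/matrixP => i j; rewrite !mxE; apply/funext => u.
rewrite vn_sumE; elim/big_ind2 : _ => // [a b e f <- <-|k _]; rewrite ?mxE //.
Qed.

Lemma vn_mx_adjoint X :
  opmx_adjoint ip (vn_mx X) = vn_mx (starmx (@vn_star _ _ ip M M_vna) X).
Proof. by apply/matrixP => i j; rewrite !mxE. Qed.

Lemma vn_mx_one : opmx_one d = vn_mx 1.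
Proof. by apply/matrixP => i j; rewrite !mxE; case: eqP. Qed.

Lemma vn_mx_unitary X : starmx (@vn_star _ _ ip M M_vna) X * X = 1 ->
  X * starmx (@vn_star _ _ ip M M_vna) X = 1 -> opmx_unitary ip (vn_mx X).
Proof.
by move=> X1 X2; split; rewrite vn_mx_adjoint vn_mx_mul ?X1 ?X2 vn_mx_one.
Qed.

(** The inequality is in fact an equality: moving the entries across the inner product produces the
    entries of [starmx X * X = 1]. *)
Lemma vn_mx_isometry_contraction X :
  starmx (@vn_star _ _ ip M M_vna) X * X = 1 -> Defs.contraction (vn_mx X).
Proof.
move=> XX v; set w := opmx_act (vn_mx X) v.
have wE i : w i = \sum_j X i j (v j).
  by rewrite ffunE; apply: eq_bigr => j _; rewrite mxE.
clearbody w.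
rewrite le_eqVlt; apply/orP; left; apply/eqP.
transitivity (\sum_i \sum_j ip (v j) (vn_star (X i j) (w i))).
  apply: eq_bigr => i _; rewrite ip_norm {1}wE ip_suml.
  by apply: eq_bigr => j _; rewrite vn_starP.
rewrite exchange_big; apply: eq_bigr => j _.
rewrite -ip_sumr ip_norm; congr (ip _ _).
transitivity (\sum_k (starmx (@vn_star _ _ ip M M_vna) X * X) j k (v k)).
  rewrite (eq_bigr (fun i => \sum_k (vn_star (X i j) * X i k) (v k))) => [|i _].
    rewrite exchange_big; apply: eq_bigr => k _ /=.
    by rewrite !mxE vn_sumE; apply: eq_bigr => i _; rewrite mxE.
  by rewrite wE (bounded_sum (vn_bounded _)).
rewrite XX (bigD1 j)//= big1 ?addr0 => [|k kj]; rewrite mxE ?eqxx//.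
by rewrite eq_sym (negPf kj).
Qed.
End OperatorMatrices.

(** * Columns of contractions *)

Definition column_contraction d (s : 'I_d -> op) :=
  forall u, \sum_i rnorm (s i u) ^+ 2 <= rnorm u ^+ 2.

Lemma Re_sum (I : Type) (r : seq I) (P : pred I) (F : I -> R[i]) :
  complex.Re (\sum_(i <- r | P i) F i) = \sum_(i <- r | P i) complex.Re (F i).
Proof. exact: raddf_sum. Qed.

(* The quadratic form [|v|^2 - |s v|^2] is nonnegative and vanishes at [u], hence
   so does its derivative. *)
Lemma column_contraction_isometric d (s : 'I_d -> op) u :
  column_contraction s -> rnorm u ^+ 2 <= \sum_i rnorm (s i u) ^+ 2 ->
  \sum_i vn_star (s i) (s i u) = u.
Proof.
move=> sc su; set g := \sum_i _.
pose h := g - u; apply/eqP; rewrite -subr_eq0 -/h; apply/eqP/rnorm_eq0.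
have gh : \sum_i ip (s i u) (s i h) - ip u h = (rnorm h ^+ 2)%:C.
  rewrite -(ip_self ip_norm) {3}/h ipDl ipNl /g ip_suml; congr (_ - _).
  by apply: eq_bigr => i _; rewrite vn_star_adjoint.
(* By [gh], the cross terms on the left exceed those on the right by [2 |h|^2], while the right side
   gains only [|h|^2] from its square. *)
have := sc (u + h); rewrite (rnorm_sqD ip_norm).
under eq_bigr => i _.
  rewrite (boundedD (vn_bounded _)) (rnorm_sqD ip_norm).
over.
rewrite !big_split /= -!mulr_sumr -Re_sum.
have -> : complex.Re (\sum_i ip (s i u) (s i h)) =
    rnorm h ^+ 2 + complex.Re (ip u h).
  by move/(congr1 (@complex.Re R)): gh; rewrite raddfB /= => <-; rewrite subrK.
have : 0 <= \sum_i rnorm (s i h) ^+ 2 by apply: sumr_ge0 => i _; apply: sqr_ge0.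
move: (\sum_i rnorm (s i h) ^+ 2) (sqr_ge0 (rnorm h)) su => n h0 su n0 le1.
by apply/eqP; rewrite -sqrf_eq0 eq_le h0 andbT; lra.
Qed.

End OperatorRingTheory.

(** * Embezzlement *)

Section EmbezzlingColumn.
Context {R : realType} {H : completeNormedModType R[i]}.
Variable ip : {dot H for (@Num.conj R[i])}.
Hypothesis ip_norm : hilbert_norm ip.
Variables (M : set (H -> H)) (M_vna : von_neumann_algebra ip M).
Local Notation op := (vn_op M_vna).
Implicit Types (x y z : op) (u v : H).

(* [p] projects onto the common kernel of the [x] in [M] with [x psi = 0]. This
   subspace is invariant under the commutant, so that [p] lies in the
   bicommutant of [M]. *)
Lemma support_projection psi : exists p : op,
  [/\ vn_star p = p, p * p = p, forall x, x psi = 0 -> x * p = 0 &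
      forall u, (forall x, x psi = 0 -> x u = 0) -> p u = u].
Proof.
pose K := [set u | forall x, x psi = 0 -> x u = 0].
have K0 : K 0 by move=> x _; apply: bounded0 (vn_bounded x).
have Ksub : complex_subspace K.
  move=> k u v Ku Kv x x0.
  rewrite (boundedD (vn_bounded x)) (boundedZ (vn_bounded x)) Ku// Kv//.
  by rewrite scaler0 addr0.
have Kcl : rclosed K.
  move=> u ucl x x0; apply: rnorm_eq0.
  have [k k0 xk] := bounded_rnorm (vn_bounded x).
  have /(_ u) : rclosed [set v | rnorm (x v) = 0].
    apply: (@rclosed_zero _ _ _ k) => [v|v w /rnorm_eq0 xw].
      exact: rnorm_ge0.
    by rewrite -[x v]subr0 -xw -(boundedB (vn_bounded x)).
  apply => e /ucl[v Kv uv]; exists v => //.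
  by rewrite /= Kv// /rnorm normr0.
have Kb b u : commutant M b -> K u -> K (b u).
  move=> [bb cb] Ku x x0.
  have := congr1 (fun f => f u) (cb _ (vn_funP x)) => /= ->.
  by rewrite Ku// (bounded0 bb).
have KE x u : x psi = 0 -> K u -> x u = 0 by move=> x0 /(_ x x0).
have Kin u : (forall x, x psi = 0 -> x u = 0) -> K u by [].
clearbody K.
have /choice[q qP] u : exists v, K v /\ forall k, K k -> ip (u - v) k = 0.
  by have [v Kv vP] := projection_exists ip_norm K0 Ksub Kcl u; exists v.
have Kq u : K (q u) := (qP u).1.
have oq u k : K k -> ip u k = ip (q u) k.
  by move=> Kk; apply/eqP; rewrite -subr_eq0 -ipNl -ipDl (qP u).2.
have q_unique u w : K w -> (forall k, K k -> ip u k = ip w k) -> q u = w.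
  move=> Kw uw; apply/eqP; rewrite -subr_eq0; apply/eqP/rnorm_eq0.
  have Kqw : K (q u - w) by rewrite addrC -scaleN1r; apply: Ksub.
  have : ip (q u - w) (q u - w) = 0 by rewrite ipDl ipNl -oq// uw// subrr.
  by rewrite (ip_self ip_norm) => -[/eqP]; rewrite sqrf_eq0 => /eqP.
have qq : is_adjoint ip q q.
  by move=> u v; rewrite [RHS](oq _ _ (Kq v)) ipC (oq _ _ (Kq u)) -ipC.
have qK u : K u -> q u = u by move=> Ku; apply: q_unique.
have bq : bounded_operator q.
  apply: (@rnorm_bounded _ _ _ 1) => [k u v|u].
    apply: q_unique; first exact: Ksub.
    by move=> w Kw; rewrite !ipDl !ipZl (oq u _ Kw) (oq v _ Kw).
  rewrite mul1r; have [->|q0] := eqVneq (rnorm (q u)) 0; first exact: rnorm_ge0.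
  have qu0 : 0 < rnorm (q u) by rewrite lt_neqAle eq_sym q0 rnorm_ge0.
  rewrite -(ler_pM2r qu0); apply: le_trans (cauchy_schwarz ip_norm _ _).
  rewrite (oq _ _ (Kq u)) (ip_self ip_norm) normc_def /= expr0n addr0.
  by rewrite sqrtr_sqr ger0_norm ?sqr_ge0.
(* For [b] in the commutant, [b (q u)] stays in [K], and it pairs with [K] as [b u] does because the
   adjoint of [b] also preserves [K]. Hence it is [q (b u)]. *)
have {Kb} Mq : M q.
  rewrite -(vna_bicommutant M_vna); split=> // b cb; apply/funext => u /=.
  apply/esym/q_unique; first exact: Kb.
  have cb' := vna_adjoint (commutant_vna ip_norm M_vna) cb.
  have ab := adjointP ip_norm cb.1.
  by move=> k Kk; rewrite !ab (oq _ _ (Kb _ _ cb' Kk)).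
exists (VnOp M_vna Mq); split.
- exact: vn_star_unique.
- by apply: vn_op_ext => u; apply: qK.
- by move=> x x0; apply: vn_op_ext => u; apply: KE (Kq u).
- by move=> u /Kin/qK.
Qed.

Lemma vn_sum_ip I (r : seq I) (P : pred I) (F : I -> op) u v :
  ip ((\sum_(i <- r | P i) F i) u) v = \sum_(i <- r | P i) ip (F i u) v.
Proof. by rewrite vn_sumE ip_suml. Qed.

Section Cuntz.
Variables (d : nat) (alpha : 'I_d -> R) (psi : H) (r : 'I_d -> op).
Hypotheses (alpha_gt0 : forall i, 0 < alpha i)
  (alpha_unit : \sum_i alpha i ^+ 2 = 1) (psi_unit : ip psi psi = 1)
  (r_contr : column_contraction r).
Hypothesis r_state : forall x i j, ip (x (r j psi)) (r i psi) =
  if i == j then (alpha i ^+ 2)%:C * ip (x psi) psi else 0.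

Lemma embezzling_cuntz : exists p : op,
  let s i := p * r i * p in
  [/\ p * p = p, p psi = psi, (forall i, p (r i psi) = r i psi),
      (forall i j, s i * vn_star (s j) = if i == j then p else 0) &
      \sum_k vn_star (s k) * s k = p].
Proof.
have [p [pst pp p0 pK]] := support_projection psi.
have ppsi : p psi = psi by apply: pK.
have ip0 u : ip u u = 0 -> u = 0.
  rewrite (ip_self ip_norm) => -[/eqP]; rewrite sqrf_eq0 => /eqP.
  exact: rnorm_eq0.
(* If [x psi = 0], the embezzlement condition for [x^* x] gives [|x (r i psi)|^2 = alpha_i^2 |x
   psi|^2 = 0]. *)
have pr i : p (r i psi) = r i psi.
  apply: pK => x x0; apply: ip0; rewrite -(vn_star_adjoint ip_norm).
  rewrite -vn_mulE r_state eqxx vn_mulE x0 (bounded0 (vn_bounded _)) ip0l.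
  by rewrite mulr0.
exists p => s; have sE i u : s i u = p (r i (p u)) by [].
have spsi i : s i psi = r i psi by rewrite sE ppsi pr.
have ps i : p * s i = s i by rewrite /s !mulrA pp.
have sp i : s i * p = s i by rewrite /s -!mulrA pp.
have starM := vn_starM ip_norm (M_vna := M_vna).
have sp' i : vn_star (s i) * p = vn_star (s i) by rewrite -{1}pst -starM ps.
have ps' i : p * vn_star (s i) = vn_star (s i) by rewrite -{1}pst -starM sp.
have p_le u : rnorm (p u) ^+ 2 <= rnorm u ^+ 2.
  have pu : ip (p u) (u - p u) = 0.
    rewrite -{1}pst vn_star_adjoint// (boundedB (vn_bounded p)) -vn_mulE pp.
    by rewrite subrr ip0r.
  have := rnorm_sqD ip_norm (p u) (u - p u).
  rewrite [p u + _]addrC subrK pu /= mulr0 addr0 => ->.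
  by rewrite lerDl sqr_ge0.
have s_contr : column_contraction s.
  move=> u; apply: le_trans (p_le u); apply: le_trans (r_contr _).
  by apply: ler_sum => i _; rewrite sE p_le.
(* The column [s] attains its norm at [psi], so the difference [D] annihilates [psi]; then
   [D * p = 0] because [psi] is separating under [p]. *)
have sum_s : \sum_k vn_star (s k) * s k = p.
  pose D := p - \sum_k vn_star (s k) * s k.
  have D0 : D psi = 0.
    rewrite /D vn_addE vn_oppE vn_sumE ppsi.
    rewrite column_contraction_isometric ?subrr//.
    rewrite (eq_bigr (fun i => alpha i ^+ 2)) => [|i _].
      rewrite alpha_unit; move: psi_unit; rewrite (ip_self ip_norm) => -[->].
      exact: lexx.
    have := r_state 1 i i; rewrite eqxx !vn_oneE psi_unit mulr1 spsi.
    by rewrite (ip_self ip_norm) => -[].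
  have := p0 _ D0; rewrite /D mulrBl pp mulr_suml.
  under eq_bigr => k _ do rewrite -mulrA sp.
  by move/eqP; rewrite subr_eq0 => /eqP.
clearbody s; split=> //.
pose g i := vn_star (s i) psi.
(* Expand the squared norm of [psi] as a double sum. The embezzlement condition for [s_i s_j^*]
   removes the terms with [i] different from [j] and evaluates the others. *)
have sum_g : \sum_i (alpha i ^+ 2)%:C * ip (g i) (g i) = 1.
  have <- : ip ((\sum_j vn_star (s j) * s j) psi)
      ((\sum_i vn_star (s i) * s i) psi) = 1 by rewrite sum_s ppsi.
  rewrite vn_sum_ip; apply: eq_bigr => j _.
  rewrite vn_sumE ip_sumr (bigD1 j)// big1 => [|i /andP[_ ij]].
    rewrite [RHS]addr0 !vn_mulE -(vn_starP ip_norm) !spsi -vn_mulE r_state eqxx.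
    by rewrite vn_mulE (vn_starP ip_norm).
  rewrite !vn_mulE -(vn_starP ip_norm) !spsi -vn_mulE r_state.
  by rewrite (negPf ij).
pose e i k := s k (g i) - (if k == i then psi else 0).
have sum_e i : \sum_k ip (e i k) (e i k) = 1 - ip (g i) (g i).
  have eE k : ip (e i k) (e i k) = ip (vn_star (s k) (s k (g i))) (g i) +
      (if k == i then 1 - ip (g i) (g i) - ip (g i) (g i) else 0).
    rewrite /e (vn_star_adjoint ip_norm); case: eqP => [->|_]; last first.
      by rewrite subr0 addr0.
    rewrite ipDl !ipDr !ipNl !ipNr psi_unit -(vn_star_adjoint ip_norm _ psi).
    by rewrite [ip (s i _) psi](vn_starP ip_norm) -/(g i) opprK; ring.
  have pg : \sum_k vn_star (s k) (s k (g i)) = g i.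
    transitivity (p (g i)); last by rewrite /g -vn_mulE ps'.
    by rewrite -sum_s vn_sumE.
  rewrite (eq_bigr _ (fun k _ => eE k)) big_split /= -ip_suml pg.
  by rewrite -big_mkcond big_pred1_eq; ring.
(* Weighted by [alpha i ^+ 2], the sums in [sum_e] add up to [1 - 1 = 0]; the terms are nonnegative
   and the weights positive. *)
have e0 i k : e i k = 0.
  have : \sum_i alpha i ^+ 2 * \sum_k rnorm (e i k) ^+ 2 = 0.
    suff : (\sum_i alpha i ^+ 2 * \sum_k rnorm (e i k) ^+ 2)%:C = 0 by case.
    rewrite rmorph_sum /= -[RHS](subrr 1) -{2}sum_g -(rmorph1 (real_complex R)).
    rewrite -alpha_unit rmorph_sum -sumrB; apply: eq_bigr => j _ /=.
    rewrite rmorphM /= rmorph_sum /=.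
    under eq_bigr => l _ do rewrite -(ip_self ip_norm).
    by rewrite sum_e mulrBr mulr1.
  move/psumr_eq0P => /(_ _ i isT) => h.
  have /eqP : alpha i ^+ 2 * \sum_k rnorm (e i k) ^+ 2 = 0.
    apply: h => j _; rewrite mulr_ge0 ?sqr_ge0 ?sumr_ge0 // => l _.
    exact: sqr_ge0.
  rewrite mulf_eq0 sqrf_eq0 (gt_eqF (alpha_gt0 i)) /= => /eqP/psumr_eq0P.
  move=> /(_ (fun j _ => sqr_ge0 _) k isT) /eqP.
  by rewrite sqrf_eq0 => /eqP/rnorm_eq0.
move=> k i.
have /p0 : (s k * vn_star (s i) - (if k == i then p else 0)) psi = 0.
  rewrite vn_addE vn_oppE -[RHS](e0 i k) /e -vn_mulE.
  by case: (k == i) => //; rewrite ppsi.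
rewrite mulrBl -mulrA sp' => /eqP; rewrite subr_eq0 => /eqP ->.
by case: (k == i); rewrite ?pp ?mul0r.
Qed.
End Cuntz.

End EmbezzlingColumn.

(** * From embezzling columns to unitaries *)

Section EmbezzlingUnitary.
Context {R : realType} {H : completeNormedModType R[i]}.
Variable ip : {dot H for (@Num.conj R[i])}.
Hypothesis ip_norm : hilbert_norm ip.
Variables (M : set (H -> H)) (M_vna : von_neumann_algebra ip M).
Local Notation op := (vn_op M_vna).
Implicit Types (x y z : op) (u v : H).

(** Contractivity gives [alpha_j^2 <= |w_j|^2], and the sums over [j] leave no slack. So the column
    attains its norm at each [w j], and [w_j] is the sum of the [r_i^* r_i w_j], where only [i = j]
    survives. *)
Lemma column_contraction_dual d (alpha : 'I_d -> R) (psi : H) (r : 'I_d -> op)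
    (w : 'I_d -> H) :
  \sum_i alpha i ^+ 2 = 1 -> ip psi psi = 1 -> column_contraction r ->
  \sum_j rnorm (w j) ^+ 2 <= 1 ->
  (forall i j, r i (w j) = if i == j then (alpha i)%:C *: psi else 0) ->
  forall j, w j = (alpha j)%:C *: vn_star (r j) psi.
Proof.
move=> alpha1 psi1 rc w1 rw j.
have psiR : rnorm psi ^+ 2 = 1.
  by move: psi1; rewrite (ip_self ip_norm) => -[].
have sum_r k : \sum_i rnorm (r i (w k)) ^+ 2 = alpha k ^+ 2.
  rewrite (bigD1 k)//= big1 => [|i ik]; last first.
    by rewrite rw (negPf ik) /rnorm normr0 /= expr0n.
  by rewrite rw eqxx rnormZ exprMn psiR mulr1 normc_sq /= expr0n !addr0.
have w_ge k : 0 <= rnorm (w k) ^+ 2 - alpha k ^+ 2.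
  by rewrite subr_ge0 -sum_r; apply: rc.
have /psumr_eq0P w0 : \sum_k (rnorm (w k) ^+ 2 - alpha k ^+ 2) = 0.
  apply/eqP; rewrite eq_le sumr_ge0 ?andbT//.
  by rewrite sumrB alpha1 subr_le0.
have wj := w0 (fun k _ => w_ge k) j isT.
have := @column_contraction_isometric _ _ _ ip_norm _ M_vna _ r (w j) rc.
rewrite sum_r -subr_le0 wj lexx => /(_ isT) <-.
rewrite (bigD1 j)// big1 => [|i /andP[_ ij]]; last first.
  by rewrite rw (negPf ij) (bounded0 (vn_bounded (vn_star (r i)))).
by rewrite [LHS]addr0 rw eqxx (boundedZ (vn_bounded (vn_star (r j)))).
Qed.

(** Here [v] is the isometry [s_o^*] and [v psi] the new catalyst. The last relation is between
    operators, not just at [psi], because the bipartite case applies it to vectors moved by the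
    commutant. *)
Lemma embezzling_unitary d (o l : 'I_d) (alpha : 'I_d -> R) (psi : H)
    (r : 'I_d -> op) :
  l != o -> (forall i, 0 < alpha i) -> \sum_i alpha i ^+ 2 = 1 ->
  ip psi psi = 1 -> column_contraction r ->
  (forall x i j, ip (x (r j psi)) (r i psi) =
     if i == j then (alpha i ^+ 2)%:C * ip (x psi) psi else 0) ->
  exists (p v : op) (U : 'M[op]_d),
    [/\ starmx (@vn_star _ _ ip M M_vna) U * U = 1,
        U * starmx (@vn_star _ _ ip M M_vna) U = 1,
        p psi = psi /\ vn_star v * v = p,
        (forall i, p (r i psi) = r i psi) &
        forall i, U i o * v = v * (p * r i * p)].
Proof.
move=> lo alpha0 alpha1 psi1 rc rs.
have [p [pp ppsi pr ss sum_s]] :=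
  embezzling_cuntz ip_norm alpha0 alpha1 psi1 rc rs.
have [||U [U1 U2 Uo]] := cuntz_unitary
  (vn_starK ip_norm (M_vna := M_vna)) (vn_starD ip_norm (M_vna := M_vna))
  (vn_starM ip_norm (M_vna := M_vna)) lo _ _ ss sum_s.
- by move=> i; rewrite !mulrA pp.
- by move=> i; rewrite -!mulrA pp.
exists p, (vn_star (p * r o * p)), U; split => //.
by rewrite (vn_starK ip_norm) ss eqxx.
Qed.

Lemma vn_column_contraction d (A : 'M[H -> H]_d) (k : 'I_d)
    (MA : entries_in M A) : Defs.contraction A ->
  column_contraction (fun i => VnOp M_vna (MA i k)).
Proof.
move=> cA u; have := cA [ffun j => if j == k then u else 0].
have -> : \sum_i `|[ffun j => if j == k then u else 0] i| ^+ 2 =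
    (rnorm u ^+ 2)%:C.
  rewrite (bigD1 k)//= big1 => [|i ik].
    by rewrite ffunE eqxx addr0 rnormE rmorphXn.
  by rewrite ffunE (negPf ik) normr0 expr0n.
suff -> : \sum_i `|opmx_act A [ffun j => if j == k then u else 0] i| ^+ 2 =
    (\sum_i rnorm (A i k u) ^+ 2)%:C by rewrite lecR.
rewrite rmorph_sum; apply: eq_bigr => i _; rewrite ffunE (bigD1 k)//= big1.
  by rewrite addr0 ffunE eqxx rnormE rmorphXn.
move=> j jk; rewrite ffunE (negPf jk).
exact: bounded0 (vna_bounded M_vna (MA i j)).
Qed.

Lemma norm_ip_eq1 u : ip u u = 1 -> `|u| = 1.
Proof. by rewrite -ip_norm => /eqP; rewrite pexpr_eq1// => /eqP. Qed.

End EmbezzlingUnitary.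

(** The norm argument yields [r_j psi = alpha_j t_j^* psi]. As [x] commutes with [t_j^*], moving the
    latter across the inner product leaves [t_j r_i psi], which is known. Stated for two commuting
    algebras, this serves both [M] and its commutant. *)
Lemma bipartite_state (R : realType) (H : completeNormedModType R[i])
    (ip : {dot H for (@Num.conj R[i])}) (ip_norm : hilbert_norm ip)
    (M N : set (H -> H)) (M_vna : von_neumann_algebra ip M)
    (N_vna : von_neumann_algebra ip N) d (alpha : 'I_d -> R) (psi : H)
    (r : 'I_d -> vn_op M_vna) (t : 'I_d -> vn_op N_vna) :
  (forall (x : vn_op M_vna) (y : vn_op N_vna) u, x (y u) = y (x u)) ->
  \sum_i alpha i ^+ 2 = 1 -> ip psi psi = 1 ->
  column_contraction r -> column_contraction t ->
  (forall i j, r i (t j psi) = if i == j then (alpha i)%:C *: psi else 0) ->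
  forall (x : vn_op M_vna) i j, ip (x (r j psi)) (r i psi) =
    if i == j then (alpha i ^+ 2)%:C * ip (x psi) psi else 0.
Proof.
move=> xy alpha1 psi1 rc tc rt x i j.
have tr k l : t k (r l psi) = if k == l then (alpha k)%:C *: psi else 0.
  by rewrite -xy rt eq_sym; case: eqP => // ->.
have r1 : \sum_k rnorm (r k psi) ^+ 2 <= 1.
  by apply: le_trans (rc _) _; move: psi1; rewrite (ip_self ip_norm) => -[->].
have rE := column_contraction_dual ip_norm alpha1 psi1 tc r1 tr.
rewrite (rE j) (boundedZ (vn_bounded _)) ipZl xy (vn_star_adjoint ip_norm) tr.
rewrite eq_sym; case: eqP => [->|_]; last by rewrite ip0r mulr0.
have conj_real (a : R) : Num.conj (a%:C : R[i]) = a%:C := conjc_real a.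
by rewrite ipZr mulrA conj_real -rmorphM expr2.
Qed.

Theorem corollary2p15 (R : realType) (d : nat) (hd : (1 < d)%N)
    (alpha : 'I_d -> R)
    (alpha_noninc : forall i j : 'I_d, (i <= j)%N -> alpha j <= alpha i)
    (alpha_gt0 : forall i, 0 < alpha i)
    (alpha_unit : \sum_i alpha i ^+ 2 = 1)
    (H : completeNormedModType R[i]) (ip : {dot H for (@Num.conj R[i])})
    (ip_norm : hilbert_norm ip)
    (M : set (H -> H)) (M_vna : von_neumann_algebra ip M)
    (psi : H) (psi_unit : `|psi| = 1) :
  (forall A : 'M[H -> H]_d,
     embezzles_monopartite ip hd alpha M A psi ->
     exists (U : 'M[H -> H]_d) (zeta : H),
       [/\ entries_in M U, opmx_unitary ip U, `|zeta| = 1 &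
           embezzles_monopartite ip hd alpha M U zeta]) /\
  (forall A B : 'M[H -> H]_d,
     embezzles_bipartite hd alpha M (commutant M) A B psi ->
     exists (U V : 'M[H -> H]_d) (eta : H),
       [/\ entries_in M U /\ opmx_unitary ip U,
           entries_in (commutant M) V /\ opmx_unitary ip V, `|eta| = 1 &
           embezzles_bipartite hd alpha M (commutant M) U V eta]).
Proof.
(* The index [l] is 1, available because [d] is at least 2; its isometry supplies the room for the
   swaps. *)
pose o : 'I_d := Ordinal (ltnW hd); pose l : 'I_d := Ordinal hd.
have lo : l != o by [].
have psi1 : ip psi psi = 1 by rewrite -ip_norm psi_unit expr1n.
split=> [A [MA cA _ Aemb]|A B [[MA cA] [MB cB] _ ABemb]].
  pose r i := VnOp M_vna (MA i o).
  have r_state (x : vn_op M_vna) i j : ip (x (r j psi)) (r i psi) =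
      if i == j then (alpha i ^+ 2)%:C * ip (x psi) psi else 0.
    have := Aemb x (vn_funP x) i j; rewrite /vector_state /= => <-.
    by rewrite (is_adjoint_sym (adjointP ip_norm (vna_bounded M_vna (MA i o)))).
  have [p [v [U [U1 U2 [ppsi vv] pr Uv]]]] := embezzling_unitary ip_norm lo
    alpha_gt0 alpha_unit psi1 (vn_column_contraction M_vna o MA cA) r_state.
  (* On [v psi] the unitary acts as the original column does on [psi], carried along by [v]; this
     transfers the embezzlement condition. *)
  have Uz i : U i o (v psi) = v (r i psi).
    by rewrite -vn_mulE Uv !vn_mulE ppsi pr.
  have z1 : `|v psi| = 1.
    apply: (norm_ip_eq1 ip_norm).
    by rewrite -(vn_star_adjoint ip_norm) -vn_mulE vv ppsi.
  have MU : entries_in M (vn_mx U) by move=> i j; rewrite mxE; apply: vn_funP.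
  exists (vn_mx U), (v psi); split=> //.
    exact: vn_mx_unitary.
  split=> //; first exact: vn_mx_isometry_contraction.
  move=> X MX i j; rewrite /vector_state /= !mxE.
  rewrite (is_adjoint_sym (adjointP ip_norm (vn_bounded (U i o)))) !Uz.
  pose x := VnOp M_vna MX.
  rewrite -(vn_star_adjoint ip_norm v) -[X _]/(x _) -!vn_mulE r_state.
  by rewrite !vn_mulE (vn_star_adjoint ip_norm).
pose N_vna := commutant_vna ip_norm M_vna.
pose r i := VnOp M_vna (MA i o); pose t i := VnOp N_vna (MB i o).
have xy (x : vn_op M_vna) (y : vn_op N_vna) u : x (y u) = y (x u).
  exact: (congr1 (fun f => f u) ((vn_funP y).2 _ (vn_funP x))).
have yx (y : vn_op N_vna) (x : vn_op M_vna) u : y (x u) = x (y u) by rewrite xy.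
have act_lr (C D : 'M[H -> H]_d) u i j :
    entries_in M C -> entries_in (commutant M) D ->
    act_left C (act_right D (basis_tensor o u o)) (i, j) = C i o (D j o u).
  move=> MC ND.
  have Dz k : act_right D (basis_tensor o u o) (k, j) =
      if k == o then D j o u else 0.
    rewrite ffunE (bigD1 o)//= big1 => [|h ho]; last first.
      rewrite ffunE xpair_eqE (negPf ho) andbF.
      exact: bounded0 (ND _ _).1.
    rewrite addr0 ffunE xpair_eqE eqxx andbT; case: eqP => // _.
    exact: bounded0 (ND _ _).1.
  rewrite ffunE (bigD1 o)//= big1 => [|h ho]; rewrite Dz ?eqxx ?addr0//.
  by rewrite (negPf ho); apply: bounded0 (vna_bounded M_vna (MC _ _)).
have sumE u i j : (\sum_k (alpha k)%:C *: basis_tensor k u k) (i, j) =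
    if i == j then (alpha i)%:C *: u else 0.
  rewrite sum_ffunE (bigD1 i)//= big1 => [|k ki].
    rewrite !ffunE addr0 xpair_eqE eqxx eq_sym /=.
    by case: eqP; rewrite ?scaler0.
  by rewrite !ffunE xpair_eqE eq_sym (negPf ki) scaler0.
have rt i j : r i (t j psi) = if i == j then (alpha i)%:C *: psi else 0.
  have := congr1 (fun f : {ffun _ -> H} => f (i, j)) ABemb.
  by rewrite act_lr// sumE.
have tr i j : t i (r j psi) = if i == j then (alpha i)%:C *: psi else 0.
  by rewrite -xy rt eq_sym; case: eqP => // ->.
have rc := vn_column_contraction M_vna o MA cA.
have tc := vn_column_contraction N_vna o MB cB.
have [p [v [U [U1 U2 [ppsi vv] pr Uv]]]] := embezzling_unitary ip_norm lo
  alpha_gt0 alpha_unit psi1 rc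
  (bipartite_state ip_norm xy alpha_unit psi1 rc tc rt).
have [p' [v' [V [V1 V2 [ppsi' vv'] pt Vv]]]] := embezzling_unitary ip_norm lo
  alpha_gt0 alpha_unit psi1 tc
  (bipartite_state ip_norm yx alpha_unit psi1 tc rc tr).
(* Since [p] commutes with [v'] and fixes [psi], it fixes [v' psi], where [v] is therefore
   isometric; likewise [v'] at [psi]. *)
have z1 : `|v (v' psi)| = 1.
  apply: norm_ip_eq1; rewrite // -(vn_star_adjoint ip_norm) -vn_mulE vv xy ppsi.
  by rewrite -(vn_star_adjoint ip_norm) -vn_mulE vv' ppsi'.
have MU : entries_in M (vn_mx U) by move=> i j; rewrite mxE; apply: vn_funP.
have NV : entries_in (commutant M) (vn_mx V).
  by move=> i j; rewrite mxE; apply: vn_funP.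
exists (vn_mx U), (vn_mx V), (v (v' psi)).
split=> //; [split=> //; exact: vn_mx_unitary..|].
split=> //; [split=> //; exact: vn_mx_isometry_contraction..|].
apply/ffunP => -[i j]; rewrite act_lr// sumE !mxE.
(* The entries of [V] commute with [v], so [V] acts on [v' psi] first; afterwards [U] meets [v] and
   turns it into [v * (p * r i * p)], whose factors pass through [v']. *)
have -> : V j o (v (v' psi)) = v (v' (t j psi)).
  by rewrite yx -[V j o _]vn_mulE Vv !vn_mulE ppsi' pt.
rewrite -vn_mulE Uv !vn_mulE !(xy p v') !(xy p (t j)) ppsi (xy (r i) v') rt.
rewrite (xy p v'); case: eqP => _.
  by rewrite !(boundedZ (vn_bounded _)) ppsi.
by rewrite !(bounded0 (vn_bounded _)).
Qed.
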